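(* Let the sequence of random graphs $G_1,G_2,\dots$ be generated by the clustering attachment model $CA^{(\alpha,\epsilon)}$ (without node and edge deletion) with initial graph $G_0$ and parameters $\alpha>0$, $\epsilon\ge 0$ and $m_0=2$. Let $\mathcal{F}_t=\sigma\{G_0,G_1,\dots,G_t\}$, $t=0,1,2,\dots$, and let $\Delta_{i,t}$ be the number of triangles of $G_t$ containing node $i$. Then for any fixed node $i$, the sequence $(\Delta_{i,0},\mathcal{F}_0),(\Delta_{i,1},\mathcal{F}_1),\dots$ is a submartingale.
   Context: Notation: for a finite set $A$, $\|A\|$ is its cardinality. All graphs are finite, undirected and simple; $G_0=(V_0,E_0)$ is a given (non-random) graph with $V_0=\{1,\dots,\|V_0\|\}$. Clustering coefficients: for a node $i\in V_t$ of $G_t=(V_t,E_t)$ let $k_{i,t}$ be its degree and $\Delta_{i,t}$ the number of triangles of $G_t$ containing $i$ (equivalently, the number of edges between neighbours of $i$). Set $c_{i,t}=0$ if $k_{i,t}\in\{0,1\}$ and $c_{i,t}=2\Delta_{i,t}/(k_{i,t}(k_{i,t}-1))$ if $k_{i,t}\ge 2$. Model $CA^{(\alpha,\epsilon)}$ with $\alpha>0$, $\epsilon\ge0$, $m_0=2$, without node and edge deletion: for $t\ge 0$, $G_{t+1}$ is obtained from $G_t$ by (i) appending a new node $\|V_0\|+t+1$; (ii) choosing a set $W_t\subset V_t$ of $m_0=2$ distinct nodes by weighted sampling without replacement with weights $$P_{CA}(i,t)=\frac{c_{i,t}^{\alpha}+\epsilon}{\sum_{j\in V_t}c_{j,t}^{\alpha}+\|V_t\|\epsilon},\qquad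 i\in V_t,$$ and adding the two edges joining the new node to the two nodes of $W_t$. No other changes are made. Thus $V_t=\{1,\dots,\|V_0\|+t\}$. Weighted sampling without replacement of two nodes means: given the graphs up to step $t$, the first node is $i$ with probability $P_{CA}(i,t)$; given that the first node is $i$, the second node is $j\ne i$ with probability $P_{CA}(j,t)/(1-P_{CA}(i,t))$. $W_t$ is the resulting unordered pair. Standing assumption on $G_0$: if $\epsilon>0$, then $\|V_0\|\ge m_0=2$; if $\epsilon=0$, then $\|\tilde V_0\|\ge m_0=2$, where $\tilde V_0=\{i\in V_0: c_{i,0}>0\}$. Convention for nodes not yet present: a node $i$ is any element of $\{1,2,3,\dots\}$, and for $t\ge1$, $\Delta_{\|V_0\|+t,s}=0$ for $0\le s<t$. *)

(* Defs.v *)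
From HB Require Import structures.
From mathcomp Require Import all_boot all_order all_algebra finmap.
From mathcomp Require Import all_classical all_reals all_analysis.

Set Implicit Arguments.
Unset Strict Implicit.
Unset Printing Implicit Defensive.

Import Order.TTheory GRing.Theory Num.Theory.
Import numFieldNormedType.Exports.

Local Open Scope classical_set_scope.
Local Open Scope fset_scope.
Local Open Scope ring_scope.

(* Finite simple graphs on nodes in [nat]: a pair (vertices, edges), an edge
   being a two-element set of vertices. *)
Definition is_simple (g : {fset nat} * {fset {fset nat}}) : bool :=
  all (fun e : {fset nat} => (e `<=` g.1) && (#|` e| == 2)%N) g.2.

Record sgraph := SGraph {
  sgraph_val : {fset nat} * {fset {fset nat}};
  _ : is_simple sgraph_val }.

HB.instance Definition _ := [isSub for sgraph_val].
HB.instance Definition _ := [Countable of sgraph by <:].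

Fact empty_graph_simple : is_simple (fset0, fset0).
Proof. by apply/allP => e; rewrite in_fset0. Qed.

HB.instance Definition _ := isPointed.Build sgraph (SGraph empty_graph_simple).

HB.instance Definition _ := @isMeasurable.Build default_measure_display sgraph
  discrete_measurable discrete_measurable0
  discrete_measurableC discrete_measurableU.

Definition vertices (g : sgraph) : {fset nat} := (sgraph_val g).1.

Definition edges (g : sgraph) : {fset {fset nat}} := (sgraph_val g).2.

(* There are no loops, so [fset i; i] is never an edge. *)
Definition neighbours (g : sgraph) (i : nat) : {fset nat} :=
  [fset j in vertices g | [fset i; j] \in edges g].

Definition degree (g : sgraph) (i : nat) : nat := #|` neighbours g i|.

Definition is_triangle (g : sgraph) (T : {fset nat}) : bool :=
  (#|` T| == 3)%N &&
  all (fun j => all (fun k => (j != k) ==> ([fset j; k] \in edges g)) T) T.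

(* This is 0 when [i] is not a vertex of [g]. *)
Definition triangles (g : sgraph) (i : nat) : nat :=
  #|` [fset T in fpowerset (vertices g) | is_triangle g T && (i \in T)]|.

Local Close Scope fset_scope.

Section clustering_attachment.
Context {R : realType}.
Variables alpha eps : R.

Definition clustering (g : sgraph) (i : nat) : R :=
  if (degree g i <= 1)%N then 0
  else 2 * (triangles g i)%:R / ((degree g i)%:R * ((degree g i)%:R - 1)).

(* For alpha > 0, [0 `^ alpha] is 0. *)
Definition P_CA (g : sgraph) (i : nat) : R :=
  (clustering g i `^ alpha + eps) /
  (\sum_(j <- vertices g) clustering g j `^ alpha + #|` vertices g|%:R * eps).

Definition admissible_initial_graph (g0 : sgraph) : Prop :=
  [/\ vertices g0 = [fset k | k in iota 1 #|` vertices g0|]%fset,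
      0 < eps -> (2 <= #|` vertices g0|)%N &
      eps = 0 ->
        (2 <= #|` [fset i in vertices g0 | (0 < clustering g0 i)%R]%fset|)%N].

Context d (T : measurableType d) (P : probability T R).

Definition cond_prob (A B : set T) : R := fine (P (A `&` B)) / fine (P B).

Definition history (G : nat -> T -> sgraph) (g : nat -> sgraph) (t : nat) :
  set T := [set w | forall s, (s <= t)%N -> G s w = g s].

(* [G] is generated by the model from [g0] with m_0 = 2, the two nodes drawn
   without replacement at step t being [first t] and [second t], in this order.
   Graphs form a countable set, so conditioning on the past is conditioning on
   the histories of positive probability; at each step the second draw is
   moreover conditioned on the outcome of the first. *)
Record clustering_attachment (g0 : sgraph) (G : nat -> {RV P >-> sgraph})
    (first second : nat -> {RV P >-> nat}) : Prop := ClusteringAttachment {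
  CA_initial : forall w, G 0%N w = g0;
  CA_draw : forall t w,
    [/\ first t w \in vertices (G t w), second t w \in vertices (G t w) &
        second t w != first t w];
  CA_vertices : forall t w,
    vertices (G t.+1 w) =
      ((#|` vertices g0| + t + 1)%N |` vertices (G t w))%fset;
  CA_edges : forall t w,
    edges (G t.+1 w) =
      (edges (G t w)
       `|` [fset [fset (#|` vertices g0| + t + 1)%N; first t w];
                 [fset (#|` vertices g0| + t + 1)%N; second t w]])%fset;
  CA_first : forall t (g : nat -> sgraph) i,
    P (history G g t) != 0%E -> i \in vertices (g t) ->
    cond_prob (first t @^-1` [set i]) (history G g t) = P_CA (g t) i;
  CA_second : forall t (g : nat -> sgraph) i j,
    P (history G g t `&` first t @^-1` [set i]) != 0%E ->
    i \in vertices (g t) -> j \in vertices (g t) -> j != i ->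
    cond_prob (second t @^-1` [set j])
              (history G g t `&` first t @^-1` [set i]) =
      P_CA (g t) j / (1 - P_CA (g t) i) }.

End clustering_attachment.

Section submartingale.
Context d (T : measurableType d) (R : realType) (P : probability T R).

Definition filtration (F : nat -> set_system T) : Prop :=
  [/\ forall t, sigma_algebra setT (F t),
      forall t, F t `<=` measurable &
      forall s t, (s <= t)%N -> F s `<=` F t].

Definition measurable_wrt (F : set_system T) (X : T -> R) : Prop :=
  forall B : set R, measurable B -> F (X @^-1` B).

(* [Y] is a version of E[X | F]. *)
Definition is_cond_exp (F : set_system T) (X Y : T -> R) : Prop :=
  [/\ measurable_wrt F Y,
      P.-integrable setT (EFin \o Y) &
      forall A, F A -> (\int[P]_(w in A) (Y w)%:E = \int[P]_(w in A) (X w)%:E)%E].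

Definition submartingale (X : nat -> T -> R) (F : nat -> set_system T) : Prop :=
  [/\ filtration F,
      forall t, measurable_wrt (F t) (X t),
      forall t, P.-integrable setT (EFin \o X t) &
      forall t, exists2 Y : T -> R,
        is_cond_exp (F t) (X t.+1) Y & {ae P, forall w, X t w <= Y w}].

End submartingale.

Definition natural_filtration d (T : measurableType d) d' (S : measurableType d')
    (G : nat -> T -> S) (t : nat) : set_system T :=
  <<s \bigcup_(s in [set s | (s <= t)%N]) g_sigma_algebra_preimage (G s) >>.

(* Main.v *)
(** An attachment step only adds a node and edges, so [Delta_{i,t}] is
    nondecreasing in [t] along every trajectory, and any version of
    [E[Delta_{i,t+1} | F_t]] dominates [Delta_{i,t}] almost surely.  Since
    there are countably many graphs, [F_t] consists of the preimages under the
    history [(G_0, ..., G_t)], and averaging over its fibres gives an explicit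
    conditional expectation.  The law of the attached pair plays no role. *)

Require Import Defs.
From mathcomp Require Import all_boot all_order all_algebra finmap.
From mathcomp Require Import all_classical all_reals all_analysis.
From mathcomp Require Import measurable_realfun.

Import Order.TTheory GRing.Theory Num.Theory.

Local Open Scope classical_set_scope.
Local Open Scope ring_scope.

(* The average of [X] over a null fibre of [H] is the junk value 0; using [y0]
   there instead makes the lower bound hold everywhere. *)
Lemma cond_exp_discrete {R : realType} {d} {T : measurableType d}
    (P : probability T R) (F : set_system T) (K : countType) (H : T -> K)
    (X : T -> R) (y0 : K -> R) (C : R) :
  F `<=` measurable ->
  (forall A, F A <-> exists B : set K, A = H @^-1` B) ->
  measurable_fun setT X ->
  (forall w, 0 <= y0 (H w) <= X w) -> (forall w, X w <= C) ->
  exists2 Y, is_cond_exp P F X Y & forall w, y0 (H w) <= Y w.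
Proof.
move=> mF FE mX y0X XC.
pose A h := H @^-1` [set h].
have mH B : measurable (H @^-1` B) by apply/mF/FE; exists B.
have mA h : measurable (A h) by exact: mH.
have PA h : P (A h) \is a fin_num by exact: fin_num_measure.
have X_ge0 w : 0 <= X w by have /andP[/le_trans] := y0X w; apply.
have mEX D : measurable D -> measurable_fun D (EFin \o X).
  by move=> mD; apply/measurable_EFinP; exact: measurable_funS mX.
pose y h := if P (A h) == 0%E then y0 h
            else fine (\int[P]_(w in A h) (X w)%:E)%E / fine (P (A h)).
(* The bounds are multiplied by the mass of the fibre, so null fibres are included. A point [w] of
   the fibre is required because [y0 h] and [C] are controlled only at values that [H] attains. *)
have int_le h w : H w = h ->
    ((y0 h)%:E * P (A h) <= \int[P]_(w in A h) (X w)%:E <= C%:E * P (A h))%E.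
  move=> Hwh; have y0h : 0 <= y0 h by rewrite -Hwh; case/andP: (y0X w).
  rewrite -!(integral_cst P (mA h)); apply/andP; split.
    apply: ge0_le_integral => //=; first exact: mEX.
    by move=> x <-; rewrite lee_fin; case/andP: (y0X x).
  apply: ge0_le_integral => //=; [by move=> x _; rewrite lee_fin|exact: mEX|].
  by move=> x _; rewrite lee_fin.
have int_fin h : (\int[P]_(w in A h) (X w)%:E)%E \is a fin_num.
  have [[w Hw]|A0] := pselect (exists w, H w = h).
    have /andP[lo hi] := int_le _ _ Hw.
    rewrite fin_numE; apply/andP; split.
      by rewrite gt_eqF// (lt_le_trans _ lo)// ltNye_eq fin_numM.
    by rewrite lt_eqF// (le_lt_trans hi)// ltey_eq fin_numM.
  have -> : A h = set0 by apply/seteqP; split => // w Hw; apply: A0; exists w.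
  by rewrite integral_set0.
have y_bnd w : y0 (H w) <= y (H w) <= C.
  rewrite /y; case: ifPn => [_|PA0].
    by rewrite lexx; have /andP[_ /le_trans] := y0X w; apply.
  have PA_gt0 : 0 < fine (P (A (H w))).
    by rewrite fine_gt0// lt0e PA0 measure_ge0 ltey_eq PA.
  have := int_le _ w erefl.
  rewrite -(fineK (int_fin _)) -(fineK (PA _)) -!EFinM !lee_fin.
  by rewrite ler_pdivlMr// ler_pdivrMr.
have FY : measurable_wrt F (y \o H).
  by move=> B mB; apply/FE; exists (y @^-1` B).
have mY : measurable_fun setT (y \o H).
  by move=> _ B mB; rewrite setTI; apply/mF/FY.
have mEY D : measurable D -> measurable_fun D (EFin \o (y \o H)).
  by move=> mD; apply/measurable_EFinP; exact: measurable_funS mY.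
have Y_ge0 w : 0 <= y (H w).
  case/andP: (y_bnd w) => /(le_trans _) + _; apply.
  by case/andP: (y0X w).
have int_fibre h :
    (\int[P]_(w in A h) (y (H w))%:E = \int[P]_(w in A h) (X w)%:E)%E.
  transitivity (\int[P]_(w in A h) cst (y h)%:E w)%E.
    by apply: eq_integral => w /set_mem ->.
  transitivity ((y h)%:E * P (A h))%E; first exact: integral_cst.
  (* On a null fibre both integrals vanish, whatever value [y] takes there. *)
  rewrite /y; case: ifPn => [/eqP PA0|PA0].
    by rewrite PA0 mule0 null_set_integral//; exact: mEX.
  rewrite -{2}(fineK (PA h)) -EFinM divfK ?fineK//.
  by rewrite fine_eq0.
exists (y \o H); last by move=> w; case/andP: (y_bnd w).
split=> //.
  apply: measurable_bounded_integrable => //.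
    by rewrite ltey_eq fin_num_measure.
  exists C; split; first exact: num_real.
  move=> M CM w _ /=; rewrite ger0_norm//.
  by case/andP: (y_bnd w) => _ /le_trans; apply; exact: ltW.
move=> D /FE[B ->].
(* Countability of [K] enters here: [pickle] is injective, so each slice is empty or a single fibre,
   and countable additivity of the integral reduces the claim to [int_fibre]. *)
pose D_ (n : nat) := H @^-1` (B `&` [set h : K | choice.pickle h = n]).
have -> : H @^-1` B = \bigcup_n D_ n.
  by apply/seteqP; split => [w Bw|w [n _ []]//]; exists (choice.pickle (H w)).
have mD n : measurable (D_ n) by exact: mH.
have tD : trivIset setT D_.
  by apply/trivIsetP => m n _ _ /eqP mn; apply/seteqP; split => // w;
    case=> -[_ /= mw] [_ /= nw]; apply: mn; rewrite -mw.
have mbD : measurable (\bigcup_n D_ n) by exact: bigcup_measurable.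
rewrite !ge0_integral_bigcup//;
  [|exact: mEX|by move=> w _; rewrite lee_fin
   |exact: mEY|by move=> w _; rewrite lee_fin Y_ge0].
apply: eq_eseriesr => n _.
have [[w [Bw nw]]|D0] := pselect (exists w, D_ n w).
  suff -> : D_ n = A (H w) by exact: int_fibre.
  apply/seteqP; split => x; last by rewrite /A /D_ /= => ->.
  by case=> _ /= nx; apply: (pcan_inj choice.pickleK); rewrite nx nw.
have -> : D_ n = set0 by apply/seteqP; split => // w Dw; apply: D0; exists w.
by rewrite !integral_set0.
Qed.

Lemma natural_filtration_filtration {d d'} {T : measurableType d}
    {S : measurableType d'} (G : nat -> T -> S) :
  (forall t, measurable_fun setT (G t)) -> filtration (natural_filtration G).
Proof.
move=> mG; split=> [t|t|s t st].
- exact: smallest_sigma_algebra.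
- apply: smallest_sub; first exact: sigma_algebra_measurable.
  by move=> A [s _ [B mB <-]]; exact: mG.
- apply: sub_sigma_algebra2 => A [r /= rs GA].
  by exists r => //=; exact: leq_trans st.
Qed.

(** As a finite function into a countable type, the history lives in a [countType], as
    [cond_exp_discrete] demands; [ord_max] indexes time [t]. *)
Definition graph_history {T : Type} (G : nat -> T -> sgraph) (t : nat) (w : T) :
    {ffun 'I_t.+1 -> sgraph} := [ffun s => G (val s) w].

(** Preimages under the history form a sigma-algebra containing the generators. Conversely, such a
    preimage is a countable union of fibres, each a finite intersection of generators. *)
Lemma natural_filtrationE {d} {T : measurableType d} (G : nat -> T -> sgraph)
    (t : nat) (A : set T) :
  natural_filtration G t A <-> exists B, A = graph_history G t @^-1` B.
Proof.
split.
  move: A; apply: smallest_sub.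
    split=> [|_ [B ->]|A_ A_E].
    - by exists set0.
    - by exists (~` B); rewrite setTD.
    - exists (\bigcup_n projT1 (cid (A_E n))).
      rewrite preimage_bigcup; apply: eq_bigcupr => n _.
      exact: projT2 (cid (A_E n)).
  move=> A [s /= st [B mB <-]].
  exists [set h | B (h (Ordinal (st : (s < t.+1)%N)))].
  by rewrite setTI; apply/seteqP; split => w /=; rewrite ffunE.
move=> [B ->].
(* [S] is [T] with the generated sigma-algebra as its measurable sets, so that closure lemmas for
   measurable sets apply to it. *)
pose S := g_sigma_algebraType
  (\bigcup_(s in [set s | (s <= t)%N]) g_sigma_algebra_preimage (G s)).
have -> : graph_history G t @^-1` B =
    \bigcup_(h in B) \bigcap_(s : 'I_t.+1) (G (val s) @^-1` [set h s]).
  apply/seteqP; split => [w Bw|w [h Bh hw]].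
    by exists (graph_history G t w) => // s _; rewrite /= ffunE.
  rewrite /= (_ : graph_history G t w = h)//.
  by apply/ffunP => s; rewrite ffunE; exact: hw.
suff mfib h : @measurable _ S
    (\bigcap_(s : 'I_t.+1) (G (val s) @^-1` [set h s])).
  (* The union over [B] becomes one over the whole countable type, with empty terms outside [B]. *)
  rewrite bigcup_mkcond; apply: (@countable_bigcupT_measurable _ S) => // h.
  by case: ifP.
apply: (@fin_bigcap_measurable _ S) => // s _; apply: sub_sigma_algebra.
exists (val s); first by rewrite /= -ltnS.
by exists [set h s] => //; rewrite setTI.
Qed.

Lemma triangles_mono (g g' : sgraph) (i : nat) :
  (vertices g `<=` vertices g')%fset -> (edges g `<=` edges g')%fset ->
  (triangles g i <= triangles g' i)%N.
Proof.
move=> /fsubsetP Vgg' /fsubsetP Egg'.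
apply/fsubset_leq_card/fsubsetP => S.
rewrite !inE /= !fpowersetE => /and3P[/fsubsetP Sg /andP[S3 /allP Sc] ->].
rewrite andbT; apply/andP; split.
  by apply/fsubsetP => j /Sg /Vgg'.
rewrite /is_triangle S3; apply/allP => j jS; apply/allP => k kS.
by apply/implyP => jk; apply: Egg'; move/allP: (Sc j jS) => /(_ k kS) /implyP;
  apply.
Qed.

Lemma triangles_le (g : sgraph) (i : nat) :
  (triangles g i <= 2 ^ #|` vertices g|)%N.
Proof.
rewrite -card_fpowerset; apply/fsubset_leq_card/fsubsetP => S.
by rewrite !inE => /andP[].
Qed.

(** Aiming only for an upper bound avoids checking that each new label is fresh. *)
Lemma CA_card_vertices_le {R : realType} {d} {T : measurableType d}
    (P : probability T R) (alpha eps : R) (g0 : sgraph)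
    (G : nat -> {RV P >-> sgraph}) (first second : nat -> {RV P >-> nat})
    (G_CA : clustering_attachment alpha eps g0 G first second) t w :
  (#|` vertices (G t w)| <= #|` vertices g0| + t)%N.
Proof.
elim: t => [|t IH]; first by rewrite (CA_initial G_CA) addn0.
rewrite (CA_vertices G_CA) cardfsU1.
by rewrite (leq_trans (leq_add (leq_b1 _) IH))// add1n addnS.
Qed.

Theorem proposition4 (R : realType) (d : measure_display)
    (T : measurableType d) (P : probability T R)
    (alpha eps : R) (alpha_gt0 : 0 < alpha) (eps_ge0 : 0 <= eps)
    (g0 : sgraph) (g0_adm : admissible_initial_graph eps g0)
    (G : nat -> {RV P >-> sgraph}) (first second : nat -> {RV P >-> nat})
    (G_CA : clustering_attachment alpha eps g0 G first second)
    (i : nat) (i_gt0 : (0 < i)%N) :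
  submartingale P (fun t w => (triangles (G t w) i)%:R)
                  (natural_filtration (fun t => G t)).
Proof.
have filt : filtration (natural_filtration (fun t => G t)).
  by apply: natural_filtration_filtration => t; exact: measurable_funP.
have mX t : measurable_fun setT (fun w => (triangles (G t w) i)%:R : R).
  by apply: (@measurableT_comp _ _ _ _ _ _ (fun g => (triangles g i)%:R : R)).
(* A deterministic bound at each time: triangles are subsets of a vertex set of size at most
   [#|vertices g0| + t]. It yields integrability. *)
pose C t : R := (2 ^ (#|` vertices g0| + t))%:R.
have X_le t w : (triangles (G t w) i)%:R <= C t.
  rewrite ler_nat (leq_trans (triangles_le _ _))// leq_pexp2l//.
  exact: (CA_card_vertices_le _ _ _ _ _ _ _ G_CA).
split=> //.
- move=> t B _; apply/natural_filtrationE.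
  exists [set h | B (triangles (h ord_max) i)%:R].
  by apply/seteqP; split => w /=; rewrite ffunE.
- move=> t; apply: measurable_bounded_integrable => //.
    by rewrite ltey_eq fin_num_measure.
  exists (C t); split; first exact: num_real.
  move=> M CM w _ /=; rewrite ger0_norm//.
  exact: le_trans (X_le t w) (ltW CM).
- move=> t.
  (* The current triangle count, read off the last graph of the history, is the lower bound for the
     count at time [t.+1]. *)
  pose y0 (h : {ffun 'I_t.+1 -> sgraph}) : R := (triangles (h ord_max) i)%:R.
  have y0E w : y0 (graph_history (fun t => G t) t w) =
               (triangles (G t w) i)%:R by rewrite /y0 ffunE.
  have [_ F_meas _] := filt.
  have [|Y EY YX] := cond_exp_discrete P _ _ _ _ y0 (C t.+1) (F_meas t)
    (natural_filtrationE _ t) (mX t.+1) _ (X_le t.+1).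
    move=> w; rewrite y0E ler0n ler_nat triangles_mono//.
      by rewrite (CA_vertices G_CA) fsubsetU1.
    by rewrite (CA_edges G_CA) fsubsetUl.
  by exists Y => //; apply: aeW => w; rewrite -y0E.
Qed.
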